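(* For the cyclic group $\mathrm{C}_p$ of prime order $p$ we have the equality $$\beta_{\mathrm{sep}}^{\mathbb{Q}}(\mathrm{C}_p)=\begin{cases} 3 & \text{ for } p\ge 3;\\ 2 & \text{ for } p=2.\end{cases}$$
   Context: For a finite group $G$, a field $\mathbb{F}$ and a finite dimensional representation $V$ of $G$ over $\mathbb{F}$, $\mathbb{F}[V]$ is the coordinate ring (polynomial algebra in the coordinate functions on $V$, with standard grading), with $G$-action $(g\cdot f)(v)=f(g^{-1}v)$, and $\mathbb{F}[V]^G$ is the subalgebra of invariants. $\beta_{\mathrm{sep}}(G,V)$ is the minimal positive integer $d$ such that for any $v,w\in V$ with $G\cdot v\neq G\cdot w$ there exists an $f\in\mathbb{F}[V]^G$ of degree at most $d$ with $f(v)\neq f(w)$. $\beta_{\mathrm{sep}}^{\mathbb{F}}(G)$ (the separating Noether number of $G$ over $\mathbb{F}$) is the maximum of $\beta_{\mathrm{sep}}(G,V)$ as $V$ ranges over all finite dimensional representations of $G$ over $\mathbb{F}$. *)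

(* Defs.v *)
From HB Require Import structures.
From mathcomp Require Import all_boot all_order all_algebra all_fingroup all_character.
From mathcomp Require Import mpoly.

Set Implicit Arguments.
Unset Strict Implicit.
Unset Printing Implicit Defensive.

Import GRing.Theory.
Local Open Scope ring_scope.

Section SeparatingNoetherNumber.

Variables (F : fieldType) (gT : finGroupType) (G : {group gT}).

Section OneRepresentation.

Variables (n : nat) (rG : mx_representation F G n).

(* V is the space of column vectors, so that g . v = rG g *m v is a left
   action; the orbit is a finite sequence, to be compared by =i. *)
Definition rep_orbit (v : 'cV[F]_n) : seq 'cV[F]_n :=
  [seq rG g *m v | g in G].

Definition coord_eval (v : 'cV[F]_n) (f : {mpoly F[n]}) : F :=
  f.@[fun i => v i 0].

(* g . f is obtained by substituting for each coordinate function 'X_i the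
   linear form v |-> (rG g^-1 *m v)_i; see coord_actE. *)
Definition coord_act (g : gT) (f : {mpoly F[n]}) : {mpoly F[n]} :=
  f \mPo [tuple \sum_(j < n) rG g^-1%g i j *: 'X_j | i < n].

Lemma coord_actE g f v :
  coord_eval v (coord_act g f) = coord_eval (rG g^-1%g *m v) f.
Proof.
rewrite /coord_eval /coord_act comp_mpoly_meval; apply: meval_eq => i.
rewrite tnth_mktuple raddf_sum mxE /=.
by apply: eq_bigr => j _; rewrite mevalZ mevalXU.
Qed.

Definition coord_invariant (f : {mpoly F[n]}) : Prop :=
  forall g, g \in G -> coord_act g f = f.

(* msize f is 1 + the total degree of f, and 0 for f = 0. *)
Definition separates_up_to (d : nat) : Prop :=
  forall v w : 'cV[F]_n, ~ (rep_orbit v =i rep_orbit w) ->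
  exists f : {mpoly F[n]},
    [/\ coord_invariant f, (msize f <= d.+1)%N & coord_eval v f <> coord_eval w f].

Definition is_beta_sep_rep (d : nat) : Prop :=
  [/\ (0 < d)%N, separates_up_to d
    & forall d', (0 < d')%N -> separates_up_to d' -> (d <= d')%N].

End OneRepresentation.

(* d is the maximum of beta_sep(G, V) over all V.  The bound also asserts that
   beta_sep(G, V) exists, so that it never holds vacuously. *)
Definition is_beta_sep (d : nat) : Prop :=
  (exists n (rG : mx_representation F G n), is_beta_sep_rep rG d) /\
  (forall n (rG : mx_representation F G n),
     exists2 e, is_beta_sep_rep rG e & (e <= d)%N).

End SeparatingNoetherNumber.

Arguments is_beta_sep F {gT} G d.

(* Main.v *)
(* Upper bound.  Let chi be a faithful character of G with values in algC, and
   to v attach V_s = sum_h chi(h)^s h v for s mod p.  Averaging products of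
   linear forms over G shows that invariants of degree at most d determine
   V_(s_1) (x) ... (x) V_(s_d) whenever s_1 + ... + s_d = 0 mod p.  As v is
   rational, the V_s with s <> 0 are Galois conjugate, so they vanish in the same
   coordinates.  If v and w are not separated in degree 2, then V_0 = W_0 and
   W_s = u_s V_s with u_s u_(-s) = 1; degree 3 adds u_s u_t = u_(s+t).  Hence
   u_s = u_1^s with u_1^p = 1, so u_1 = chi(x) for some x in G, and Fourier
   inversion gives w = x^-1 v.  For p = 2 degree 2 suffices, as s = 1 is the only
   nonzero weight.

   Lower bound.  In the regular representation the constant 1 and p times the
   indicator of the identity agree on invariants of degree 1, while, for p > 2,
   the function with value 1 at the identity, 2 at a generator and 0 elsewhere
   agrees with its reflection on invariants of degree 2. *)
Require Import Defs.
From mathcomp Require Import all_boot all_order all_algebra all_fingroup all_solvable.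
From mathcomp Require Import all_field all_character mpoly.
From Stdlib Require Import Classical.

Set Implicit Arguments.
Unset Strict Implicit.
Unset Printing Implicit Defensive.

(** * Invariants as averages over the group, and the existence of the separating number *)

Section Invariants.

Import GRing.Theory.
Local Open Scope ring_scope.

Variable F : fieldType.

Lemma msizeM_leD n (a b : nat) (f h : {mpoly F[n]}) :
  (msize f <= a.+1)%N -> (msize h <= b.+1)%N -> (msize (f * h) <= (a + b).+1)%N.
Proof.
have [->|f0] := eqVneq f 0; first by rewrite mul0r msize0.
have [->|h0] := eqVneq h 0; first by rewrite mulr0 msize0.
by move=> fa hb; rewrite msizeM // -subn1 leq_subLR add1n -addnS -addSn leq_add.
Qed.

Lemma msize_prod_le n (I : Type) (r : seq I) (P : pred I) (d : I -> nat)
    (f : I -> {mpoly F[n]}) :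
  (forall i, P i -> (msize (f i) <= (d i).+1)%N) ->
  (msize (\prod_(i <- r | P i) f i) <= (\sum_(i <- r | P i) d i).+1)%N.
Proof.
move=> fd; apply: (big_ind2 (fun a b => (msize a <= b.+1)%N)) => //.
- by rewrite msize1.
- by move=> a1 b1 a2 b2; apply: msizeM_leD.
Qed.

Lemma msizeX_le n (f : {mpoly F[n]}) d k :
  (msize f <= d.+1)%N -> (msize (f ^+ k) <= (d * k).+1)%N.
Proof.
move=> fd; elim: k => [|k IH]; first by rewrite expr0 msize1 muln0.
by rewrite exprS mulnS; apply: msizeM_leD.
Qed.

Variables (gT : finGroupType) (G : {group gT}) (n : nat).
Variable rG : mx_representation F G n.

Lemma tnth_coord_act g i :
  tnth [tuple \sum_(j < n) rG g^-1%g i j *: 'X_j | i < n] i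
    = \sum_(j < n) rG g^-1%g i j *: 'X_j :> {mpoly F[n]}.
Proof. by rewrite tnth_mktuple. Qed.

Lemma msize_coord_act_form g i :
  (msize (\sum_(j < n) rG g^-1%g i j *: 'X_j : {mpoly F[n]}) <= 2)%N.
Proof.
apply: (leq_trans (msize_sum _ _ _)); apply/bigmax_leqP => j _.
by rewrite (leq_trans (msizeZ_le _ _)) // msizeX mdeg1.
Qed.

Lemma msize_coord_act g (f : {mpoly F[n]}) :
  (msize (coord_act rG g f) <= msize f)%N.
Proof.
rewrite /coord_act comp_mpolyE; apply: (leq_trans (msize_sum _ _ _)).
apply/bigmax_leqP_seq => m mf _.
apply: (leq_trans (msizeZ_le _ _)).
apply: leq_trans (msize_mdeg_lt mf); rewrite mdegE.
apply: msize_prod_le => i _; rewrite -[X in (_ <= X.+1)%N]mul1n; apply: msizeX_le.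
by rewrite tnth_coord_act msize_coord_act_form.
Qed.

Lemma coord_actX g i : coord_act rG g 'X_i = \sum_(j < n) rG g^-1%g i j *: 'X_j.
Proof. by rewrite /coord_act comp_mpolyXU -tnth_nth tnth_coord_act. Qed.

Lemma coord_actM g h f : g \in G -> h \in G ->
  coord_act rG h (coord_act rG g f) = coord_act rG (h * g)%g f.
Proof.
move=> gG hG; rewrite /coord_act !(comp_mpolyE f) raddf_sum /=.
apply: eq_bigr => m _; rewrite comp_mpolyZ rmorph_prod /=; congr (_ *: _).
apply: eq_bigr => i _; rewrite rmorphXn /= !tnth_coord_act; congr (_ ^+ _).
rewrite raddf_sum /=.
under eq_bigr => j _ do
  rewrite comp_mpolyZ comp_mpolyXU -tnth_nth tnth_coord_act scaler_sumr.
rewrite exchange_big /=; apply: eq_bigr => k _.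
rewrite invMg repr_mxM ?groupV // mxE scaler_suml.
by apply: eq_bigr => j _; rewrite scalerA.
Qed.

(** The transfer, without the factor [1/#|G|], so that it makes sense in every characteristic. *)
Definition reynolds (f : {mpoly F[n]}) : {mpoly F[n]} :=
  \sum_(g in G) coord_act rG g f.

Lemma reynolds_invariant f : coord_invariant rG (reynolds f).
Proof.
move=> h hG; rewrite /reynolds /coord_act raddf_sum /=.
rewrite [RHS](reindex_inj (mulgI h)) /=; apply: eq_big => g; first by rewrite groupMl.
by move=> gG; exact: coord_actM.
Qed.

Lemma msize_reynolds f : (msize (reynolds f) <= msize f)%N.
Proof.
apply: (leq_trans (msize_sum _ _ _)); apply/bigmax_leqP => g _.
exact: msize_coord_act.
Qed.

Lemma coord_eval_reynolds v f :
  coord_eval v (reynolds f) = \sum_(g in G) coord_eval (rG g *m v) f.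
Proof.
rewrite /coord_eval /reynolds raddf_sum (reindex_inj invg_inj) /=.
apply: eq_big => g; first by rewrite groupV.
by move=> _; have := coord_actE rG g^-1%g f v; rewrite /coord_eval invgK.
Qed.

Lemma coord_eval_prod m (I : finType) (v : 'cV[F]_m) (f : I -> {mpoly F[m]}) :
  coord_eval v (\prod_i f i) = \prod_i coord_eval v (f i).
Proof. by rewrite /coord_eval rmorph_prod. Qed.

Lemma coord_evalX (m : nat) (v : 'cV[F]_m) i : coord_eval v 'X_i = v i 0.
Proof. exact: mevalXU. Qed.

Definition unseparated D (v w : 'cV[F]_n) := forall f,
  coord_invariant rG f -> (msize f <= D.+1)%N -> coord_eval v f = coord_eval w f.

(** Each side evaluates the transfer of a product of [d] linear forms, namely translates of
    coordinate functions; this transfer is an invariant of degree at most [d]. *)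
Lemma unseparated_orbit_sum D v w (d : nat) (a : 'I_d -> gT) (j : 'I_d -> 'I_n) :
  unseparated D v w -> (d <= D)%N -> (forall i, a i \in G) ->
  \sum_(g in G) \prod_i (rG (a i) *m (rG g *m v)) (j i) 0
  = \sum_(g in G) \prod_i (rG (a i) *m (rG g *m w)) (j i) 0.
Proof.
move=> vw dD aG.
have E u : \sum_(g in G) \prod_i (rG (a i) *m (rG g *m u)) (j i) 0
    = coord_eval u (reynolds (\prod_i coord_act rG (a i)^-1%g 'X_(j i))).
  rewrite coord_eval_reynolds; apply: eq_bigr => g gG; rewrite coord_eval_prod.
  by apply: eq_bigr => i _; rewrite coord_actE coord_evalX invgK.
rewrite !E; apply: vw; first exact: reynolds_invariant.
apply: (leq_trans (msize_reynolds _)).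
apply: (@leq_trans (\sum_(i < d) 1).+1); last by rewrite sum1_card card_ord.
by apply: msize_prod_le => i _; rewrite coord_actX msize_coord_act_form.
Qed.

Lemma rep_orbit_act v x : x \in G -> rep_orbit rG (rG x *m v) =i rep_orbit rG v.
Proof.
move=> xG u; apply/imageP/imageP => -[h hG ->].
  by exists (h * x)%g; rewrite ?groupM // mulmxA repr_mxM.
exists (h * x^-1)%g; first by rewrite groupM ?groupV.
by rewrite mulmxA -repr_mxM ?groupM ?groupV // mulgKV.
Qed.

Lemma rep_orbit_refl v : v \in rep_orbit rG v.
Proof. by apply/imageP; exists 1%g => //; rewrite repr_mx1 mul1mx. Qed.

Lemma separates_up_toP D :
  (forall v w, unseparated D v w -> exists2 x, x \in G & w = rG x *m v) ->
  separates_up_to rG D.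
Proof.
move=> H v w vw; apply: NNPP => nf; apply: vw.
have [|x xG ->] := H v w; last by move=> u; rewrite rep_orbit_act.
move=> f fI fD; apply/eqP/negPn/negP => /eqP ne; apply: nf.
by exists f.
Qed.

Lemma separates_up_to_leq d e : (d <= e)%N ->
  separates_up_to rG d -> separates_up_to rG e.
Proof.
move=> de H v w /H[f [fI fd ne]]; exists f; split=> //.
by apply: leq_trans fd _; rewrite ltnS.
Qed.

Lemma is_beta_sep_repS D : separates_up_to rG D.+1 -> ~ separates_up_to rG D ->
  is_beta_sep_rep rG D.+1.
Proof.
move=> H nH; split=> // d d0 Hd; rewrite ltnNge; apply/negP => dD; apply: nH.
exact: separates_up_to_leq Hd.
Qed.

(** A descent from [D] to the least positive separating degree, with excluded middle deciding
    separation at each stage. *)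
Lemma is_beta_sep_rep_exists D : (0 < D)%N -> separates_up_to rG D ->
  exists2 e, is_beta_sep_rep rG e & (e <= D)%N.
Proof.
elim: D => // -[|D] IH _ H; first by exists 1%N.
have [/IH[] // e He leD|nH] := classic (separates_up_to rG D.+1).
  by exists e => //; exact: leqW.
by exists D.+2 => //; exact: is_beta_sep_repS.
Qed.

End Invariants.

(** * Fourier analysis on a group of prime order: the upper bound *)

Section PrimeOrder.

Import GRing.Theory Num.Theory.
Local Open Scope ring_scope.

Variables (gT : finGroupType) (G : {group gT}) (p : nat).
Hypotheses (p_prime : prime p) (G_order : #|G| = p).

(** The kernels of the irreducible characters meet trivially, so one of these linear characters is
    not 1 at a generator; its value there has order dividing [p], hence exactly [p]. *)
Lemma prime_order_faithful_character : exists (chi : gT -> algC) (g : gT),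
  [/\ g \in G, G :=: <[g]>%g, {in G &, {morph chi : x y / (x * y)%g >-> x * y}}
    & p.-primitive_root (chi g)].
Proof.
have ab i : 'chi[G]_i \is a linear_char.
  by apply: irr_cyclic_lin; rewrite prime_cyclic // G_order.
have Gn1 : G :!=: 1%g by rewrite -cardG_gt1 G_order prime_gt1.
have [g gG g1] := trivgPn _ Gn1.
have gen : G :=: <[g]>%g by apply: nt_gen_prime; rewrite ?G_order // !inE g1.
have [i gi] : exists i, 'chi[G]_i g != 1.
  apply/existsP; rewrite -negb_forall; apply/negP => /forallP H.
  case/eqP: g1; apply/set1gP; rewrite -(TI_cfker_irr G); apply/bigcapP => i _.
  by rewrite cfkerEirr inE lin_char1 //; exact: negbNE (H i).
exists 'chi_i, g; split=> //; first exact: lin_charM.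
have z1 : 'chi_i g ^+ p = 1.
  by rewrite -lin_charX // -G_order expg_cardG // lin_char1.
have [m pm md] := prim_order_exists (prime_gt0 p_prime) z1.
have /orP[/eqP m1|/eqP <- //] : (m == 1%N) || (m == p) by case/primeP: p_prime => _; apply.
by move: pm gi; rewrite m1 => /prim_expr_order; rewrite expr1 => ->; rewrite eqxx.
Qed.

Variables (chi : gT -> algC) (g : gT).
Hypotheses (gG : g \in G) (g_gen : G :=: <[g]>%g).
Hypothesis chiM : {in G &, {morph chi : x y / (x * y)%g >-> x * y}}.
Hypothesis chi_prim : p.-primitive_root (chi g).

Let p_gt0 : (0 < p)%N := prime_gt0 p_prime.

Lemma chi1 : chi 1%g = 1.
Proof.
have := chiM gG (group1 G); rewrite mulg1 -{1}[chi g]mulr1 => /mulfI -> //.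
by rewrite (prim_root_eq0 chi_prim) -lt0n.
Qed.

Lemma chi_expg k : chi (g ^+ k)%g = chi g ^+ k.
Proof.
elim: k => [|k IH]; first by rewrite expg0 chi1.
by rewrite expgS chiM ?groupX // IH exprS.
Qed.

Lemma chi_cycle h : h \in G -> exists k, h = (g ^+ k)%g.
Proof. by rewrite g_gen => /cycleP. Qed.

Lemma chiXp h : h \in G -> chi h ^+ p = 1.
Proof.
by move=> /chi_cycle[k ->]; rewrite chi_expg exprAC (prim_expr_order chi_prim) expr1n.
Qed.

Lemma chi_onto u : u ^+ p = 1 -> exists2 h, h \in G & chi h = u.
Proof.
move/(prim_rootP chi_prim) => [k ->]; exists (g ^+ k)%g; first exact: groupX.
exact: chi_expg.
Qed.

Lemma chi_eq1 h : h \in G -> (chi h == 1) = (h == 1%g).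
Proof.
move=> /chi_cycle[k ->]; rewrite chi_expg -(prim_order_dvd chi_prim).
by rewrite -order_dvdn /order -g_gen G_order.
Qed.

Lemma sum_chi h : h \in G -> \sum_(s < p) chi h ^+ s = (h == 1%g)%:R * p%:R.
Proof.
move=> hG; have [->|h1] := eqVneq h 1%g.
  rewrite chi1 mul1r; under eq_bigr do rewrite expr1n.
  by rewrite sumr_const card_ord.
rewrite mul0r; have := subrX1 (chi h) p; rewrite chiXp // subrr => /esym/eqP.
by rewrite mulf_eq0 subr_eq0 chi_eq1 // (negbTE h1) => /eqP.
Qed.

Variables (n : nat) (rG : mx_representation rat G n).

(** Coordinate [i] of the vector V_s, taken in [algC] although [v] is rational. *)
Definition fourier (s : nat) (v : 'cV[rat]_n) (i : 'I_n) : algC :=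
  \sum_(h in G) chi h ^+ s * ratr ((rG h *m v) i 0).

Lemma fourier_act s v i x : x \in G ->
  chi x ^+ s * fourier s (rG x *m v) i = fourier s v i.
Proof.
move=> xG; rewrite [RHS](reindex_inj (mulIg x)) mulr_sumr /=.
apply: eq_big => h; first by rewrite groupMr.
by move=> hG; rewrite chiM // repr_mxM // mulmxA mulrA exprMn [chi x ^+ s * _]mulrC.
Qed.

Lemma fourier_inv v i : \sum_(s < p) fourier s v i = p%:R * ratr (v i 0).
Proof.
rewrite exchange_big /= (bigD1 1%g) //= [X in _ + X]big1 => [|h /andP[hG h1]].
  by rewrite -mulr_suml sum_chi // eqxx mul1r repr_mx1 mul1mx addr0.
by rewrite -mulr_suml sum_chi // (negbTE h1) !mul0r.
Qed.

(** Some automorphism of [algC] raises all [p]-th roots of unity to the power [s]. It fixes the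
    rational coordinates, so it maps V_1 to V_s. *)
Lemma fourier_conj (s : nat) v i : coprime s p ->
  (fourier s v i == 0) = (fourier 1 v i == 0).
Proof.
move=> cop; have [u uE] := Qn_aut_exists cop.
rewrite -[RHS](fmorph_eq0 u) rmorph_sum; congr (_ == _).
apply: eq_bigr => h hG; rewrite rmorphM /= expr1 uE ?chiXp //.
by rewrite fmorph_rat.
Qed.

(** As the weights sum to 0 mod [p], the product is unchanged when [rG h] acts on the vector.
    Summing over [h] and expanding the product of sums turns it into a combination of orbit sums,
    which agree for [v] and [w]. *)
Lemma fourier_prod D d v w (s : 'I_d -> nat) (j : 'I_d -> 'I_n) :
  unseparated rG D v w -> (d <= D)%N -> (p %| \sum_i s i)%N ->
  \prod_i fourier (s i) v (j i) = \prod_i fourier (s i) w (j i).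
Proof.
move=> vw dD ps.
pose coef (f : {ffun 'I_d -> gT}) := \prod_i chi (f i) ^+ s i.
pose term (u : 'cV[rat]_n) (f : {ffun 'I_d -> gT}) :=
  \sum_(h in G) \prod_i (rG (f i) *m (rG h *m u)) (j i) 0.
have E u : p%:R * \prod_i fourier (s i) u (j i)
    = \sum_(f in ffun_on (mem G)) coef f * ratr (term u f).
  transitivity (\sum_(h in G) \prod_i fourier (s i) (rG h *m u) (j i)).
    rewrite -G_order -sum1_card natr_sum mulr_suml; apply: eq_bigr => h hG.
    have chi_prod : \prod_i chi h ^+ s i = 1.
      by rewrite prodrXr; have /dvdnP[q ->] := ps; rewrite mulnC exprM chiXp ?expr1n.
    rewrite mul1r -[RHS]mul1r -[X in _ = X * _]chi_prod.
    by rewrite -big_split /=; apply: eq_bigr => i _; rewrite fourier_act.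
  under eq_bigr => h hG do rewrite bigA_distr_big.
  rewrite exchange_big /=; apply: eq_bigr => f _.
  rewrite /term rmorph_sum mulr_sumr; apply: eq_bigr => h hG.
  by rewrite big_split /= rmorph_prod.
have p0 : p%:R != 0 :> algC by rewrite pnatr_eq0 -lt0n.
apply: (mulfI p0); rewrite !E; apply: eq_bigr => f /ffun_onP fG; congr (_ * ratr _).
exact: (unseparated_orbit_sum _ vw).
Qed.

Section Unseparated.

Variables (D : nat) (v w : 'cV[rat]_n).
Hypotheses (vw : unseparated rG D v w) (D_gt1 : (1 < D)%N).
Hypothesis D_gt2 : (2 < p)%N -> (2 < D)%N.

Local Notation V := (fun s i => fourier s v i).
Local Notation W := (fun s i => fourier s w i).

Lemma fourier_eq0 i : V 0%N i = W 0%N i.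
Proof.
have := @fourier_prod D 1 v w (fun=> 0%N) (fun=> i) vw (ltnW D_gt1).
by rewrite !big_ord1; apply.
Qed.

Lemma fourier_eq2 s t i j : (p %| s + t)%N -> V s i * V t j = W s i * W t j.
Proof.
move=> st.
have := @fourier_prod D 2 v w (tnth [tuple s; t]) (tnth [tuple i; j]) vw D_gt1.
by rewrite !big_ord_recl !big_ord0 /= addn0 !mulr1; apply.
Qed.

Lemma fourier_eq3 s t r i j k : (2 < p)%N -> (p %| s + t + r)%N ->
  V s i * V t j * V r k = W s i * W t j * W r k.
Proof.
move=> p2 str.
have := @fourier_prod D 3 v w (tnth [tuple s; t; r]) (tnth [tuple i; j; k])
  vw (D_gt2 p2).
by rewrite !big_ord_recl !big_ord0 /= addn0 !mulr1 !mulrA !addnA; apply.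
Qed.

Lemma coprime_lt s : (0 < s < p)%N -> coprime s p.
Proof.
move=> /andP[s0 sp]; rewrite coprime_sym prime_coprime //.
by apply: contraL sp => /dvdn_leq; rewrite -leqNgt; apply.
Qed.

Lemma fourier_orbit x : x \in G ->
  (forall s i, (s < p)%N -> W s i = chi x ^+ s * V s i) -> w = rG x^-1%g *m v.
Proof.
move=> xG Wx; apply/colP => i; apply: (fmorph_inj (ratr : rat -> algC)).
have p0 : p%:R != 0 :> algC by rewrite pnatr_eq0 -lt0n.
apply: (mulfI p0); rewrite -!fourier_inv; apply: eq_bigr => s _.
rewrite Wx // -{1}(@fourier_act s v i x^-1%g) ?groupV // mulrA -exprMn.
by rewrite -chiM ?groupV // mulgV chi1 expr1n mul1r.
Qed.

Lemma unseparated_orbit : exists2 x, x \in G & w = rG x *m v.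
Proof.
have p1 := prime_gt1 p_prime.
have [/existsP[i0 nz]|] := boolP [exists i, V 1%N i != 0]; last first.
  rewrite negb_exists => /forallP Z.
  have V0 s i : (0 < s < p)%N -> V s i = 0.
    by move=> /coprime_lt/fourier_conj E; apply/eqP; rewrite E; apply/negPn/Z.
  have p10 : (0 < p.-1 < p)%N by rewrite -subn1 subn_gt0 p1 ltn_subrL p_gt0.
  have W0 s i : (0 < s < p)%N -> W s i = 0.
    move=> /coprime_lt/fourier_conj E; apply/eqP; rewrite E.
    (* The product of W_1 and W_(p-1) at [i] vanishes, and the two factors are conjugate, so both
       are 0. *)
    have := @fourier_eq2 1 p.-1 i i; rewrite add1n prednK // dvdnn => /(_ isT).
    rewrite V0 // mul0r => /esym/eqP; rewrite mulf_eq0 => /orP[] //.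
    by rewrite fourier_conj // coprime_lt.
  exists 1^-1%g; first by rewrite groupV.
  apply: fourier_orbit => // -[|s] i sp; first by rewrite mul1r fourier_eq0.
  by rewrite V0 // W0 // mulr0.
have nzV s : (0 < s < p)%N -> V s i0 != 0 by move=> /coprime_lt/fourier_conj ->.
(* The ratio is read off at the single coordinate [i0], where every V_s with 0 < s < p is nonzero by
   conjugacy; [Wu] then extends it to all coordinates by pairing [s] with [p - s]. *)
pose u s := W s i0 / V s i0.
have Ws s : (0 < s < p)%N -> W s i0 = u s * V s i0 by move=> sp; rewrite /u divfK ?nzV.
have lt_opp s : (0 < s < p)%N -> (0 < p - s < p)%N.
  by move=> /andP[s0 sp]; rewrite subn_gt0 sp ltn_subrL s0.
have uV s : (0 < s < p)%N -> u s * u (p - s)%N = 1.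
  move=> sp; have spo := lt_opp s sp; have /andP[_ /ltnW sp'] := sp.
  have := @fourier_eq2 s (p - s) i0 i0; rewrite subnKC // dvdnn => /(_ isT)/esym.
  rewrite !Ws // mulrACA -[RHS]mul1r => /mulIf; apply.
  by rewrite mulf_neq0 ?nzV.
have Wu s i : (0 < s < p)%N -> W s i = u s * V s i.
  move=> sp; have spo := lt_opp s sp; have /andP[_ /ltnW sp'] := sp.
  have := @fourier_eq2 s (p - s) i i0; rewrite subnKC // dvdnn => /(_ isT).
  rewrite (Ws (p - s)%N) // mulrA => /mulIf -/(_ (nzV _ spo)) ->.
  by rewrite mulrCA uV // mulr1.
(* The bounds force [p > 2], so degree 3 is available. The weights [s], 1 and [p - s.+1] give u_s
   u_1 u_(p-s-1) = 1, to be compared with u_(s+1) u_(p-s-1) = 1. *)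
have uS s : (0 < s)%N -> (s.+1 < p)%N -> u s.+1 = u s * u 1%N.
  move=> s0 sp; have p2 : (2 < p)%N by apply: leq_ltn_trans sp; rewrite ltnS.
  have b1 : (0 < 1 < p)%N by [].
  have bs : (0 < s < p)%N by rewrite s0 ltnW.
  have bS : (0 < s.+1 < p)%N by [].
  have bo := lt_opp _ bS.
  have := @fourier_eq3 s 1 (p - s.+1) i0 i0 i0 p2.
  rewrite addn1 subnKC 1?ltnW // dvdnn => /(_ isT)/esym.
  rewrite !Ws // (mulrACA (u s)) (mulrACA (u s * _)) -[RHS]mul1r => /mulIf E.
  have {}E := E _; rewrite !mulf_neq0 ?nzV // in E; have {}E := E isT.
  apply: (mulIf (x := u (p - s.+1)%N)); last by rewrite E uV.
  by apply: contra_eq_neq (uV _ bS) => ->; rewrite mulr0 eq_sym oner_neq0.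
have uX s : (0 < s < p)%N -> u s = u 1%N ^+ s.
  elim: s => // -[_ _|s IH /andP[_ sp]]; first by rewrite expr1.
  by rewrite uS // IH 1?[RHS]exprSr //= ltnW.
have [x xG xu] : exists2 h, h \in G & chi h = u 1%N.
  (* Here u_1^p = u_1 u_1^(p-1) = u_1 u_(p-1) = 1. *)
  apply: chi_onto; rewrite -(prednK p_gt0) exprS -uX -?subn1 ?uV //.
  by rewrite lt_opp.
exists x^-1%g; rewrite ?groupV //; apply: fourier_orbit => // -[|s] i sp.
  by rewrite mul1r fourier_eq0.
by rewrite xu -uX // Wu.
Qed.

End Unseparated.
End PrimeOrder.

(** * A criterion for non-separation when the group order is invertible *)

Section OrbitSums.

Import GRing.Theory.
Local Open Scope ring_scope.

Variables (F : fieldType) (gT : finGroupType) (G : {group gT}) (n : nat).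
Variable rG : mx_representation F G n.
Hypothesis natr_cardG_neq0 : #|G|%:R != 0 :> F.

Lemma prod_exp_mnm (m : 'X_{1..n}) : exists2 s : seq 'I_n, size s = mdeg m
  & forall x : 'I_n -> F, \prod_i x i ^+ m i = \prod_(i <- s) x i.
Proof.
exists (flatten [seq nseq (m i) i | i <- enum 'I_n]).
  rewrite size_flatten /shape -map_comp mdegE sumnE big_map big_enum /=.
  by apply: eq_bigr => i _; rewrite size_nseq.
move=> x; rewrite big_flatten big_map big_enum /=.
by apply: eq_bigr => i _; rewrite big_nseq iter_mulr_1.
Qed.

(** For an invariant [f], the value at [u] times [#|G|] is the sum of [f] over the translates of
    [u]; expanding [f] into monomials leaves the orbit sums of the hypothesis. *)
Lemma unseparated_of_orbit_sum D (v w : 'cV[F]_n) :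
  (forall s : seq 'I_n, (size s <= D)%N ->
    \sum_(g in G) \prod_(i <- s) (rG g *m v) i 0
    = \sum_(g in G) \prod_(i <- s) (rG g *m w) i 0) ->
  unseparated rG D v w.
Proof.
move=> H f fI fD.
have E u : #|G|%:R * coord_eval u f = \sum_(g in G) coord_eval (rG g *m u) f.
  rewrite -sum1_card natr_sum mulr_suml; apply: eq_bigr => g gG.
  by rewrite -[g]invgK -coord_actE fI ?groupV // mul1r.
apply: (mulfI natr_cardG_neq0); rewrite !E /coord_eval.
under eq_bigr => g _ do rewrite mevalE.
under [RHS]eq_bigr => g _ do rewrite mevalE.
rewrite exchange_big [RHS]exchange_big /= big_seq [RHS]big_seq.
apply: eq_bigr => m mf; rewrite -!mulr_sumr; congr (_ * _).
have [s sm xs] := prod_exp_mnm m.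
under eq_bigr => g _ do rewrite xs.
under [RHS]eq_bigr => g _ do rewrite xs.
by apply: H; rewrite sm -ltnS (leq_trans (msize_mdeg_lt mf)).
Qed.

Lemma not_separates_up_to D (v w : 'cV[F]_n) : unseparated rG D v w ->
  (forall x, x \in G -> w <> rG x *m v) -> ~ separates_up_to rG D.
Proof.
move=> vw nw /(_ v w)[] => [|f [fI fD]]; last by apply; apply: vw.
move=> /(_ w); rewrite rep_orbit_refl => /imageP[x xG]; exact: nw.
Qed.

End OrbitSums.

(** * Functions on the group under right translation: the lower bound *)

Section RegularRepresentation.

Import GRing.Theory Num.Theory.
Local Open Scope ring_scope.

Variables (F : numFieldType) (gT : finGroupType) (G : {group gT}).

Local Notation aG := (regular_repr F G).

Definition regular_col (a : gT -> F) : 'cV[F]_#|G| := \col_i a (enum_val i).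

Lemma regular_act x a : x \in G ->
  aG x *m regular_col a = regular_col (fun h => a (h * x)%g).
Proof.
move=> xG; apply/colP => i; rewrite !mxE.
rewrite (bigD1 (gring_index G (enum_val i * x)%g)) //=.
rewrite big1 => [|j ji]; last by rewrite !mxE (negbTE ji) mul0r.
by rewrite !mxE !eqxx mul1r addr0 gring_indexK // groupM ?enum_valP.
Qed.

Lemma regular_orbit_sum a (s : seq 'I_#|G|) :
  \sum_(g in G) \prod_(i <- s) (aG g *m regular_col a) i 0
  = \sum_(g in G) \prod_(i <- s) a (enum_val i * g)%g.
Proof.
by apply: eq_bigr => g gG; apply: eq_bigr => i _; rewrite regular_act // mxE.
Qed.

Lemma natr_cardG_neq0 : #|G|%:R != 0 :> F.
Proof. by rewrite pnatr_eq0 -lt0n cardG_gt0. Qed.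

Lemma regular_col_neq_act a b :
  (forall x, x \in G -> exists2 h, h \in G & b h != a (h * x)%g) ->
  forall x, x \in G -> regular_col b <> aG x *m regular_col a.
Proof.
move=> ab x xG; rewrite regular_act // => /colP E; have [h hG /eqP[]] := ab x xG.
by have := E (gring_index G h); rewrite !mxE gring_indexK.
Qed.

Lemma sum_translate a x : x \in G -> \sum_(g in G) a (x * g)%g = \sum_(g in G) a g :> F.
Proof.
move=> xG; rewrite [RHS](reindex_inj (mulgI x)); apply: eq_bigl => g.
by rewrite groupMl.
Qed.

Lemma regular_not_separates1 : (1 < #|G|)%N -> ~ separates_up_to aG 1.
Proof.
rewrite cardG_gt1 => /trivgPn[k kG k1].
pose a := fun _ : gT => 1 : F; pose b := fun h : gT => (h == 1%g)%:R * #|G|%:R : F.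
apply: (not_separates_up_to (v := regular_col a) (w := regular_col b)).
  apply: unseparated_of_orbit_sum => [|[|i []] // _]; first exact: natr_cardG_neq0.
    by under eq_bigr do rewrite big_nil; under [RHS]eq_bigr do rewrite big_nil.
  rewrite !regular_orbit_sum.
  under eq_bigr do rewrite big_seq1; under [RHS]eq_bigr do rewrite big_seq1.
  rewrite !sum_translate ?enum_valP // sumr_const (bigD1 1%g) //= big1 => [|h].
    by rewrite /b eqxx mul1r addr0.
  by rewrite /b => /andP[_ /negbTE->]; rewrite mul0r.
(* Every translate of [a] is 1 at [k], where [b] vanishes. *)
apply: regular_col_neq_act => x xG; exists k => //.
by rewrite /a /b (negbTE k1) mul0r eq_sym oner_eq0.
Qed.

(* A function on an abelian group and its reflection have the same
   autocorrelation, hence the same invariants of degree at most 2. *)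
Lemma reflection_unseparated a : abelian G ->
  unseparated aG 2 (regular_col a) (regular_col (fun h => a h^-1%g)).
Proof.
move=> abG; apply: unseparated_of_orbit_sum => [|s ss]; first exact: natr_cardG_neq0.
rewrite !regular_orbit_sum.
case: s ss => [|i [|j []]] // _.
- by under eq_bigr do rewrite big_nil; under [RHS]eq_bigr do rewrite big_nil.
- under eq_bigr do rewrite big_seq1; under [RHS]eq_bigr do rewrite big_seq1.
  rewrite sum_translate ?enum_valP // (sum_translate (fun h => a h^-1%g)) ?enum_valP //.
  by rewrite (reindex_inj invg_inj); apply: eq_bigl => h; rewrite groupV.
have xG := enum_valP i; have yG := enum_valP j.
set x := enum_val i in xG *; set y := enum_val j in yG *.
under eq_bigr do rewrite big_cons big_seq1.
under [RHS]eq_bigr do rewrite big_cons big_seq1.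
(* By commutativity, this substitution sends [x * g] to [(y * h)^-1] and [y * g] to [(x * h)^-1], so
   the two factors come out swapped. *)
have inj : injective (fun h => (x * y * h)^-1)%g.
  by move=> h1 h2 /invg_inj /mulgI.
rewrite (reindex_inj inj) /=; apply: eq_big => h.
  by rewrite groupV groupMl // groupM.
rewrite groupV groupMl ?groupM // => hG.
have cancel s t : s \in G -> t \in G -> (s * (s * t)^-1 = t^-1)%g.
  by move=> sG tG; rewrite invMg mulgA (centsP abG s) ?groupV // mulgK.
rewrite mulrC; congr (a _ * a _).
  by rewrite (centsP abG x xG y yG) -mulgA cancel ?groupM.
by rewrite -mulgA cancel ?groupM.
Qed.

Lemma regular_not_separates2 : abelian G ->
  (exists2 g, g \in G & (g ^+ 2 != 1)%g) -> ~ separates_up_to aG 2.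
Proof.
move=> abG [g gG g2].
have g1 : (g != 1)%g by apply: contraNneq g2 => ->; rewrite expg1n.
(* The two weights must differ: the indicator of {1, g} has a translate as its reflection. *)
pose a h : F := (h == 1%g)%:R + 2%:R * (h == g)%:R.
apply: (not_separates_up_to (reflection_unseparated a abG)).
apply: regular_col_neq_act => x xG.
(* For [x = 1], the reflection is 2 at [g^-1] while [a] is 0 there. Otherwise the reflection is 1 at
   the identity, whereas the translate takes the value [a x], which is 0 or 2. *)
have [x1|x1] := eqVneq x 1%g; [exists g^-1%g|exists 1%g]; rewrite ?groupV //.
  have /negbTE gV : g^-1%g != g.
    by apply: contraNneq g2 => gV; rewrite expgS expg1 -{1}gV mulVg.
  rewrite x1 mulg1 invgK /a eqxx invg_eq1 (negbTE g1) gV !add0r mulr1 mulr0.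
  by rewrite pnatr_eq0.
rewrite mul1g invg1 /a eqxx (negbTE x1) (eq_sym 1%g) (negbTE g1) add0r mulr0 addr0.
by rewrite -natrM eqr_nat; case: (x == g).
Qed.

End RegularRepresentation.

Theorem corollary4p2 (p : nat) (gT : finGroupType) (G : {group gT})
    (p_prime : prime p) (G_cyclic : cyclic G) (G_order : #|G| = p) :
  is_beta_sep rat G (if p == 2 then 2 else 3).
Proof.
have [chi [g [gG g_gen chiM chi_prim]]] :=
  prime_order_faithful_character p_prime G_order.
set D := if _ then _ else _.
have D_gt1 : 1 < D by rewrite /D; case: eqP.
have D_gt2 : 2 < p -> 2 < D by rewrite /D; case: eqP => // ->.
have sep n (rG : mx_representation rat G n) : separates_up_to rG D.
  apply: separates_up_toP => v w vw.
  exact: (unseparated_orbit p_prime G_order gG g_gen chiM chi_prim vw).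
split=> [|n rG]; last by apply: is_beta_sep_rep_exists => //; exact: ltnW.
exists #|G|, (regular_repr rat G); have := sep _ (regular_repr rat G).
rewrite /D; case: eqP => p2 sepD; apply: is_beta_sep_repS => //.
  by apply: regular_not_separates1; rewrite G_order prime_gt1.
apply: regular_not_separates2; first exact: cyclic_abelian.
(* The generator has order [p], which does not divide 2 since [p] is a prime other than 2. *)
exists g => //; rewrite -order_dvdn /order -g_gen G_order dvdn_prime2 //.
exact/eqP.
Qed.
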